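(* Let $M$ be a smooth manifold endowed with a metric contact pair $(\alpha_1,\alpha_2,\phi,g)$ and suppose that $\phi$ is decomposable. Then, for $i\neq j$, $i,j\in\{1,2\}$, $(\alpha_i,\phi,g)$ induces (by restriction, with Reeb vector field the restriction of $Z_i$) a contact metric structure on the leaves of the characteristic foliation $\mathcal{F}_j$ of $\alpha_j$.
   Context: All objects are smooth; $\Gamma(TM)$ denotes the space of vector fields on $M$. A contact pair of type $(h,k)$ on $M$ is a pair $(\alpha_1,\alpha_2)$ of $1$-forms such that $\alpha_1\wedge(d\alpha_1)^h\wedge\alpha_2\wedge(d\alpha_2)^k$ is a volume form, $(d\alpha_1)^{h+1}=0$ and $(d\alpha_2)^{k+1}=0$. Its Reeb vector fields $Z_1,Z_2$ are the two commuting vector fields uniquely determined by $\alpha_i(Z_j)=\delta_{ij}$ and $i_{Z_j}d\alpha_i=0$ for $i,j=1,2$. For $i=1,2$, the distribution $\ker\alpha_i\cap\ker d\alpha_i$ (where $\ker d\alpha_i=\{X : i_Xd\alpha_i=0\}$) is completely integrable and its foliation $\mathcal{F}_i$ is called the characteristic foliation of $\alpha_i$; $T\mathcal{F}_i$ denotes its tangent bundle. One has $Z_1\in\Gamma(T\mathcal{F}_2)$ and $Z_2\in\Gamma(T\mathcal{F}_1)$. A contact pair structure on $M$ is a triple $(\alpha_1,\alpha_2,\phi)$ where $(\alpha_1,\alpha_2)$ is a contact pair and $\phi$ is a tensor field of type $(1,1)$ with $\phi^2=-Id+\alpha_1\otimes Z_1+\alpha_2\otimes Z_2$ and $\phi(Z_1)=\phi(Z_2)=0$.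 The endomorphism $\phi$ is decomposable if $\phi(T\mathcal{F}_i)\subset T\mathcal{F}_i$ for $i=1,2$. A Riemannian metric $g$ is associated with respect to $(\alpha_1,\alpha_2,\phi)$ if $g(X,\phi Y)=(d\alpha_1+d\alpha_2)(X,Y)$ and $g(X,Z_i)=\alpha_i(X)$ for $i=1,2$ and all $X,Y\in\Gamma(TM)$. A metric contact pair (MCP) is a $4$-tuple $(\alpha_1,\alpha_2,\phi,g)$ where $(\alpha_1,\alpha_2,\phi)$ is a contact pair structure and $g$ is an associated metric with respect to it. An almost contact structure on a manifold $N$ is a triple $(\alpha,Z,\phi)$ of a $1$-form, a vector field and a field of endomorphisms of $TN$ with $\phi^2=-Id+\alpha\otimes Z$, $\phi(Z)=0$, $\alpha(Z)=1$. A contact metric structure $(\alpha,Z,\phi,g)$ on $N$ is an almost contact structure $(\alpha,Z,\phi)$ where $\alpha$ is a contact form and $Z$ its Reeb vector field ($\alpha(Z)=1$, $i_Zd\alpha=0$), together with a Riemannian metric $g$ on $N$ that is associated, i.e. $g(X,\phi Y)=d\alpha(X,Y)$ and $g(X,Z)=\alpha(X)$ for all $X,Y\in\Gamma(TN)$. *)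

(* Defs.v *)
From mathcomp Require Import all_boot all_order all_algebra all_fingroup.
From mathcomp Require Import all_classical all_reals all_analysis.

Set Implicit Arguments.
Unset Strict Implicit.
Unset Printing Implicit Defensive.

Import Order.TTheory GRing.Theory Num.Theory.
Import numFieldNormedType.Exports.
Local Open Scope classical_set_scope.
Local Open Scope ring_scope.

Section Smooth.
Context (R : realType) (V W : normedModType R).

(* Meaningful for U open. *)
Fixpoint Ck (k : nat) (U : set V) (f : V -> W) : Prop :=
  match k with
  | 0 => forall x, U x -> {for x, continuous f}
  | k'.+1 => (forall x, U x -> differentiable f x) /\
             (forall v, Ck k' U ('D_v f))
  end.

Definition smooth_on (U : set V) (f : V -> W) : Prop := forall k, Ck k U f.

End Smooth.

Section Exterior.
Context (R : realType) (V : lmodType R).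

Definition wedge (p q : nat) (a : ('I_p -> V) -> R) (b : ('I_q -> V) -> R) :
    ('I_(p + q) -> V) -> R :=
  fun v => (p`! * q`!)%:R^-1 *
    \sum_(s : 'S_(p + q)) (-1) ^+ s *
      (a (fun i => v (s (lshift q i))) * b (fun j => v (s (rshift p j)))).

Fixpoint wedge_exp (p : nat) (a : ('I_p -> V) -> R) (k : nat) {struct k} :
    ('I_(k * p) -> V) -> R :=
  match k with
  | 0 => fun=> 1
  | k'.+1 => wedge a (@wedge_exp p a k')
  end.

Definition form1 (a : V -> R) : ('I_1 -> V) -> R := fun v => a (v ord0).

Definition form2 (b : V -> V -> R) : ('I_2 -> V) -> R :=
  fun v => b (v ord0) (v ord_max).

End Exterior.

Arguments wedge_exp {R V p} a k v.

(* Smooth n-manifolds without boundary. The inverse [param c] of [chart c] is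
   only meaningful on the image of [dom c]. As any atlas determines a unique
   maximal one, the atlas is not required to be maximal. [chart_at p] is a
   preferred chart around p, used only to name the elements of T_p M. *)
Record manifold (R : realType) (n : nat) := Manifold {
  space :> topologicalType;
  atlas : Type;
  dom : atlas -> set space;
  chart : atlas -> space -> 'rV[R]_n;
  param : atlas -> 'rV[R]_n -> space;
  chart_at : space -> atlas;
  space_hausdorff : hausdorff_space space;
  space_second_countable : @second_countable space;
  dom_chart_at : forall p, dom (chart_at p) p;
  dom_open : forall c, open (dom c);
  chart_image_open : forall c, open (chart c @` dom c);
  chartK : forall c p, dom c p -> param c (chart c p) = p;
  chart_continuous : forall c p, dom c p -> {for p, continuous (chart c)};
  param_continuous : forall c x, (chart c @` dom c) x ->
    {for x, continuous (param c)};
  transition_smooth : forall c d,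
    smooth_on (chart c @` (dom c `&` dom d)) (chart d \o param c)
}.

Section Tensors.
Context (R : realType) (n : nat) (M : manifold R n).

(* A tangent vector at p is given by its coordinates in the basis of T_p M
   defined by the preferred chart at p. *)
Definition tangent (p : M) : normedModType R := 'rV[R]_n.

(* The value at p of the constant-coefficient field \sum_i v_i d/dx_i attached
   to the chart c; conversely, [components c w] are the coordinates of w in the
   basis (d/dx_i) of the chart c. *)
Definition coord_vec (c : atlas M) (p : M) (v : 'rV[R]_n) : tangent p :=
  'D_v (chart (chart_at p) \o param c) (chart c p).

Definition components (c : atlas M) (p : M) (w : tangent p) : 'rV[R]_n :=
  'D_w (chart c \o param (chart_at p)) (chart (chart_at p) p).

Definition smooth_in_chart (W : normedModType R) (c : atlas M) (f : M -> W) :=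
  smooth_on (chart c @` dom c) (f \o param c).

Definition vector_field (X : forall p, tangent p) : Prop :=
  forall c, smooth_in_chart c (fun p => components c (X p)).

Definition one_form (a : forall p, tangent p -> R) : Prop :=
  (forall p, scalar (a p)) /\
  (forall c v, smooth_in_chart c (fun p => a p (coord_vec c p v))).

Definition endomorphism_field (f : forall p, tangent p -> tangent p) : Prop :=
  (forall p, linear (f p)) /\
  (forall c v, smooth_in_chart c
     (fun p => components c (f p (coord_vec c p v)))).

Definition riemannian_metric (g : forall p, tangent p -> tangent p -> R) :
    Prop :=
  [/\ forall p u, scalar (g p u),
      forall p u v, g p u v = g p v u,
      forall p v, v != 0 -> 0 < g p v v &
      forall c u v, smooth_in_chart c
        (fun p => g p (coord_vec c p u) (coord_vec c p v))].

(* da(U, V) = U a(V) - V a(U) for the coordinate fields U and V extending u and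
   v in the preferred chart at p (so that [U, V] = 0); no factor 1/2. *)
Definition ext_deriv (a : forall p, tangent p -> R) (p : M)
    (u v : tangent p) : R :=
  let c := chart_at p in
  let coef w := fun x => a (param c x) (coord_vec c (param c x) w) in
  'D_u (coef v) (chart c p) - 'D_v (coef u) (chart c p).

Definition volume_form (q : nat) (w : forall p, ('I_q -> tangent p) -> R) :
    Prop :=
  q = n /\ forall p, exists v, w p v != 0.

Definition contact_form (a : forall p, tangent p -> R) : Prop :=
  one_form a /\
  exists k, volume_form
    (fun p => wedge (form1 (a p)) (wedge_exp (form2 (@ext_deriv a p)) k)).

Definition contact_pair (h k : nat) (a1 a2 : forall p, tangent p -> R) :
    Prop :=
  [/\ one_form a1, one_form a2,
      volume_form (fun p =>
        wedge (form1 (a1 p))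
          (wedge (wedge_exp (form2 (@ext_deriv a1 p)) h)
            (wedge (form1 (a2 p))
              (wedge_exp (form2 (@ext_deriv a2 p)) k)))),
      (forall p v, wedge_exp (form2 (@ext_deriv a1 p)) h.+1 v = 0) &
      (forall p v, wedge_exp (form2 (@ext_deriv a2 p)) k.+1 v = 0)].

Definition reeb_pair (a1 a2 : forall p, tangent p -> R)
    (Z1 Z2 : forall p, tangent p) : Prop :=
  [/\ vector_field Z1 /\ vector_field Z2,
      forall p, a1 p (Z1 p) = 1 /\ a1 p (Z2 p) = 0,
      forall p, a2 p (Z1 p) = 0 /\ a2 p (Z2 p) = 1,
      forall p v, ext_deriv a1 (Z1 p) v = 0 /\ ext_deriv a1 (Z2 p) v = 0 &
      forall p v, ext_deriv a2 (Z1 p) v = 0 /\ ext_deriv a2 (Z2 p) v = 0].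

Definition contact_pair_structure (h k : nat)
    (a1 a2 : forall p, tangent p -> R) (Z1 Z2 : forall p, tangent p)
    (f : forall p, tangent p -> tangent p) : Prop :=
  [/\ contact_pair h k a1 a2,
      reeb_pair a1 a2 Z1 Z2,
      endomorphism_field f,
      forall p v, f p (f p v) = - v + a1 p v *: Z1 p + a2 p v *: Z2 p &
      forall p, f p (Z1 p) = 0 /\ f p (Z2 p) = 0].

Definition metric_contact_pair (h k : nat)
    (a1 a2 : forall p, tangent p -> R) (Z1 Z2 : forall p, tangent p)
    (f : forall p, tangent p -> tangent p)
    (g : forall p, tangent p -> tangent p -> R) : Prop :=
  [/\ contact_pair_structure h k a1 a2 Z1 Z2 f,
      riemannian_metric g,
      forall p (u v : tangent p),
        g p u (f p v) = ext_deriv a1 u v + ext_deriv a2 u v &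
      forall p u, g p u (Z1 p) = a1 p u /\ g p u (Z2 p) = a2 p u].

Definition char_distribution (a : forall p, tangent p -> R) (p : M) :
    set (tangent p) :=
  [set v | a p v = 0 /\ forall w, ext_deriv a v w = 0].

Arguments char_distribution a p : clear implicits.

Definition decomposable (a1 a2 : forall p, tangent p -> R)
    (f : forall p, tangent p -> tangent p) : Prop :=
  forall p, f p @` char_distribution a1 p `<=` char_distribution a1 p /\
            f p @` char_distribution a2 p `<=` char_distribution a2 p.

Definition almost_contact_structure (a : forall p, tangent p -> R)
    (Z : forall p, tangent p) (f : forall p, tangent p -> tangent p) : Prop :=
  [/\ [/\ one_form a, vector_field Z & endomorphism_field f],
      forall p v, f p (f p v) = - v + a p v *: Z p,
      forall p, f p (Z p) = 0 &
      forall p, a p (Z p) = 1].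

Definition contact_metric_structure (a : forall p, tangent p -> R)
    (Z : forall p, tangent p) (f : forall p, tangent p -> tangent p)
    (g : forall p, tangent p -> tangent p -> R) : Prop :=
  [/\ almost_contact_structure a Z f,
      contact_form a,
      forall p, a p (Z p) = 1 /\ forall v, ext_deriv a (Z p) v = 0,
      riemannian_metric g &
      (forall p (u v : tangent p), g p u (f p v) = ext_deriv a u v) /\
      (forall p u, g p u (Z p) = a p u)].

End Tensors.

Arguments char_distribution {R n M} a p.

Section Leaves.
Context (R : realType) (m n : nat) (L : manifold R m) (M : manifold R n).

Definition smooth_map (i : L -> M) : Prop :=
  continuous i /\
  forall c d, smooth_on (chart c @` (dom c `&` i @^-1` dom d))
                        (chart d \o i \o param c).

Definition tangent_map (i : L -> M) (q : L) (v : tangent q) :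
    tangent (i q) :=
  'D_v (chart (chart_at (i q)) \o i \o param (chart_at q))
       (chart (chart_at q) q).

(* L is in general only injectively immersed, not embedded. *)
Definition connected_integral_manifold (D : forall p : M, set (tangent p))
    (i : L -> M) : Prop :=
  [/\ [set: L] !=set0 /\ connected [set: L],
      smooth_map i,
      injective i,
      forall q, injective (@tangent_map i q) &
      forall q, range (@tangent_map i q) = D (i q)].

Definition pullback1 (i : L -> M) (a : forall p : M, tangent p -> R) (q : L) :
    tangent q -> R :=
  fun v => a (i q) (tangent_map i v).

Definition pullback2 (i : L -> M)
    (g : forall p : M, tangent p -> tangent p -> R) (q : L) :
    tangent q -> tangent q -> R :=
  fun u v => g (i q) (tangent_map i u) (tangent_map i v).

Arguments pullback1 i a q : clear implicits.
Arguments pullback2 i g q : clear implicits.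

(* ZL and fL are the restrictions of Z and f to L; they are unique because the
   tangent map of i is injective. *)
Definition induces_contact_metric (i : L -> M)
    (a : forall p : M, tangent p -> R) (Z : forall p : M, tangent p)
    (f : forall p : M, tangent p -> tangent p)
    (g : forall p : M, tangent p -> tangent p -> R) : Prop :=
  exists (ZL : forall q : L, tangent q) (fL : forall q : L, tangent q -> tangent q),
    [/\ forall q, tangent_map i (ZL q) = Z (i q),
        forall q v, tangent_map i (fL q v) = f (i q) (tangent_map i v) &
        contact_metric_structure (pullback1 i a) ZL fL (pullback2 i g)].

End Leaves.

Arguments pullback1 {R m n L M} i a q.
Arguments pullback2 {R m n L M} i g q.

(* Leaves of an integrable distribution: its maximal connected integral
   manifolds. *)
Definition leaf (R : realType) (m n : nat) (L : manifold R m)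
    (M : manifold R n) (D : forall p : M, set (tangent p)) (i : L -> M) : Prop :=
  connected_integral_manifold D i /\
  forall m' (L' : manifold R m') (i' : L' -> M),
    connected_integral_manifold D i' ->
    range i `<=` range i' -> range i' `<=` range i.

(* Main.v *)
(* A tangent vector of the leaf L of F_j is a tangent vector of M killed by
   alpha_j and d(alpha_j). As exterior differentiation commutes with the
   pullback to L, the identities defining a contact metric structure on L are
   thus those of the metric contact pair, in which the terms coming from alpha_j
   vanish. The fields Z_i and phi are tangent to L (for phi this is
   decomposability); their restrictions are smooth because in charts they solve
   a linear system whose matrix, the Jacobian of L -> M, is injective.
   Finally, TL has an orthonormal basis Z, phi e_1, e_1, ..., phi e_k, e_k, on
   which alpha ^ (d alpha)^k is positive, so alpha is a contact form on L. *)
From mathcomp Require Import all_boot all_order all_algebra all_fingroup.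
From mathcomp Require Import all_classical all_reals all_analysis.
From mathcomp Require Import ring lra zify.
Require Import Defs.

Set Implicit Arguments.
Unset Strict Implicit.
Unset Printing Implicit Defensive.

Import Order.TTheory GRing.Theory Num.Theory.
Import numFieldNormedType.Exports.
Local Open Scope classical_set_scope.
Local Open Scope ring_scope.

(** * Functions of class C^k *)

(** A tangent vector is a coordinate row in a preferred chart that changes from point to point, and
    [param] means nothing off the chart image. Regularity is therefore proved on open sets of
    coordinates where an explicit formula holds, and carried over by [eq_Ck]. With F the map [i]
    read in charts, d(i^*a) and i^*(da) differ by a linear expression in D_u D_v F - D_v D_u F,
    which is why symmetry of second derivatives is needed. The restrictions of Z_i and phi are
    chosen point by point, so their regularity has to be recovered afterwards. The exponent of the
    volume form on a leaf is not taken from h or k but from the dimension: an adapted frame is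
    enlarged until it fills the tangent space, which also proves that this dimension is odd. *)

Lemma near_eq_differentiable (R : numFieldType) (V W : normedModType R)
    (f g : V -> W) (x : V) :
  {near x, f =1 g} -> differentiable f x -> differentiable g x.
Proof.
move=> fg df.
(* As [g - f] vanishes near [x], it is differentiable there with differential 0. *)
have -> : g = f + (g - f) by rewrite addrC subrK.
apply: differentiableD => //.
have gf0 : \near x, (g - f) x = 0.
  by near=> y; apply/eqP; rewrite subr_eq0 eq_sym; apply/eqP; near: y.
have e0 : (g - f) \o shift x = cst ((g - f) x) + \0 +o_ 0 id.
  apply/eqaddoP => _/posnumP[e].
  have := gf0; rewrite (near_shift 0) subr0 => h.
  near=> y.
  rewrite (nbhs_singleton gf0) !fctE /=.
  have -> : g (y + x) - f (y + x) = 0 by near: y.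
  by rewrite !(subr0, addr0) normr0 mulr_ge0.
have /diff_unique/(_ e0) d0 : continuous (\0 : V -> W) by apply: cst_continuous.
apply/diff_locallyP; rewrite d0; split => //; exact: cst_continuous.
Unshelve. all: by end_near. Qed.

Section Ck_theory.
Context (R : realType).
Implicit Types V W : normedModType R.

Lemma eq_Ck V W k (U : set V) (f g : V -> W) : open U ->
  (forall x, U x -> f x = g x) -> Ck k U f -> Ck k U g.
Proof.
move=> oU; elim: k f g => [|k IH] f g fg /=.
  move=> fc x Ux.
  have near_fg : \forall y \near x, f y = g y.
    by apply: filterS (open_nbhs_nbhs (conj oU Ux)).
  apply: cvg_trans (near_eq_cvg near_fg) _.
  by rewrite -(fg _ Ux); exact: fc.
move=> [fd fk].
have near_fg x : U x -> {near x, f =1 g}.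
  by move=> Ux; apply: filterS (open_nbhs_nbhs (conj oU Ux)).
split=> [x Ux|v]; first exact: near_eq_differentiable (near_fg _ Ux) (fd _ Ux).
by apply: IH (fk v) => x Ux; apply: near_eq_derive; apply: near_fg.
Qed.

(** Every clause of [Ck] is a condition at single points, and ['D_v f] does not mention the set. *)
Lemma Ck_local V W k (U : set V) (f : V -> W) :
  (forall x, U x -> exists2 U', U' x & Ck k U' f) -> Ck k U f.
Proof.
elim: k f => [|k IH] f /= fU.
  by move=> x /fU[U' U'x]; apply.
split=> [x /fU[U' U'x [fd _]]|v]; first exact: fd.
by apply: IH => x /fU[U' U'x [_ fk]]; exists U'.
Qed.

Lemma CkW V W k (U : set V) (f : V -> W) : Ck k.+1 U f -> Ck k U f.
Proof.
elim: k f => [|k IH] f [fd fk]; first by move=> x /fd /differentiable_continuous.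
by split=> // v; apply/IH/fk.
Qed.

Lemma Ck_cst V W k (U : set V) (a : W) : Ck k U (cst a).
Proof.
elim: k a => [|k IH] a /=; first by move=> x _; exact: cst_continuous.
split=> [x _|v]; first exact: differentiable_cst.
have -> : 'D_v (cst a) = cst 0 by apply/funext => x; exact: derive_cst.
exact: IH.
Qed.

Lemma CkD V W k (U : set V) (f g : V -> W) : open U ->
  Ck k U f -> Ck k U g -> Ck k U (f + g).
Proof.
move=> oU; elim: k f g => [|k IH] f g /=.
  by move=> fc gc x Ux; apply: continuousD; [exact: fc|exact: gc].
move=> [fd fk] [gd gk]; split=> [x Ux|v].
  by apply: differentiableD; [exact: fd|exact: gd].
apply: eq_Ck (IH _ _ (fk v) (gk v)) => // x Ux.
by rewrite deriveD //; apply: diff_derivable; [exact: fd|exact: gd].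
Qed.

Lemma CkM V k (U : set V) (f g : V -> R) : open U ->
  Ck k U f -> Ck k U g -> Ck k U (f * g).
Proof.
move=> oU; elim: k f g => [|k IH] f g.
  by move=> fc gc x Ux; apply: continuousM; [exact: fc|exact: gc].
move=> fk1 gk1; have [fd fk] := fk1; have [gd gk] := gk1.
split=> [x Ux|v].
  by apply: differentiableM; [exact: fd|exact: gd].
apply: eq_Ck (CkD oU (IH _ _ (CkW fk1) (gk v)) (IH _ _ (CkW gk1) (fk v))) => //.
move=> x Ux.
by rewrite deriveM //; apply: diff_derivable; [exact: fd|exact: gd].
Qed.

Lemma Ck_sum V W k (U : set V) (I : Type) (r : seq I) (P : pred I)
    (f : I -> V -> W) : open U ->
  (forall i, P i -> Ck k U (f i)) -> Ck k U (fun x => \sum_(i <- r | P i) f i x).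
Proof.
move=> oU fk; elim: r => [|i r IH].
  by apply: eq_Ck (Ck_cst _ _ 0) => // x Ux; rewrite big_nil.
have [Pi|/negbTE Pi] := boolP (P i).
  by apply: (eq_Ck oU _ (CkD oU (fk i Pi) IH)) => x Ux; rewrite big_cons Pi.
by apply: eq_Ck IH => // x Ux; rewrite big_cons Pi.
Qed.

Lemma Ck_prod V k (U : set V) (I : Type) (r : seq I) (P : pred I)
    (f : I -> V -> R) : open U ->
  (forall i, P i -> Ck k U (f i)) ->
  Ck k U (fun x => \prod_(i <- r | P i) f i x).
Proof.
move=> oU fk; elim: r => [|i r IH].
  by apply: (eq_Ck oU _ (Ck_cst k U (1 : R))) => x Ux; rewrite big_nil.
have [Pi|/negbTE Pi] := boolP (P i).
  by apply: (eq_Ck oU _ (CkM oU (fk i Pi) IH)) => x Ux; rewrite big_cons Pi.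
by apply: eq_Ck IH => // x Ux; rewrite big_cons Pi.
Qed.

(** Induction through D_v (1/f) = - (1/f)^2 D_v f, where 1/f on the right is only needed one order
    lower. *)
Lemma CkV V k (U : set V) (f : V -> R) : open U ->
  (forall x, U x -> f x != 0) -> Ck k U f -> Ck k U (fun x => (f x)^-1).
Proof.
move=> oU f0; elim: k => [|k IH].
  by move=> fc x Ux; apply: continuousV; [exact: f0|exact: fc].
move=> fk1; have [fd fk] := fk1.
split=> [x Ux|v]; first by apply: differentiableV; [exact: fd|exact: f0].
have fV := IH (CkW fk1).
have := CkM oU (CkM oU (Ck_cst k U (-1 : R)) (CkM oU fV fV)) (fk v).
apply: eq_Ck => // x Ux; rewrite deriveV ?f0 //; last exact/diff_derivable/fd.
by rewrite /= !fctE mulN1r -exprVn expr2.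
Qed.

Lemma derive_coord V m n (f : V -> 'M[R]_(m, n)) x v i j : differentiable f x ->
  'D_v (fun y => f y i j) x = 'D_v f x i j.
Proof. by move=> /diff_derivable df; rewrite derive_mx // mxE. Qed.

Lemma Ck_coord V m n k (U : set V) (f : V -> 'M[R]_(m, n)) i j : open U ->
  Ck k U f -> Ck k U (fun x => f x i j).
Proof.
move=> oU; elim: k f => [|k IH] f /=.
  move=> fc x Ux; apply: (@continuous_comp _ _ _ f (fun M => M i j)).
    exact: fc.
  exact: coord_continuous.
move=> [fd fk]; split=> [x Ux|v].
  apply: (@differentiable_comp _ _ _ _ f (fun M : 'M[R]_(m, n) => M i j)).
    exact: fd.
  exact: differentiable_coord.
apply: eq_Ck (IH _ (fk v)) => // x Ux.
by rewrite derive_coord //; exact: fd.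
Qed.

Lemma CkZl V W k (U : set V) (f : V -> R) (w : W) : open U ->
  Ck k U f -> Ck k U (fun x => f x *: w).
Proof.
move=> oU; elim: k f => [|k IH] f /=.
  by move=> fc x Ux; apply: cvgZr_tmp; exact: fc.
move=> [fd fk]; split=> [x Ux|v]; first exact/differentiableZl/fd.
apply: (eq_Ck oU _ (IH _ (fk v))) => x Ux.
by rewrite [RHS]deriveE ?diffZl -?deriveE //; try exact/differentiableZl/fd; exact: fd.
Qed.

Lemma Ck_row V n k (U : set V) (f : V -> 'rV[R]_n) : open U ->
  (forall j, Ck k U (fun x => f x 0 j)) -> Ck k U f.
Proof.
move=> oU fk.
have fE x : U x -> \sum_j f x 0 j *: (delta_mx 0 j : 'rV[R]_n) = f x.
  by rewrite -row_sum_delta.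
by apply: (eq_Ck oU fE); apply: Ck_sum => // j _; apply: CkZl.
Qed.

Lemma derive_comp V W (X : normedModType R) (f : V -> W) (h : W -> X) x v :
  differentiable f x -> differentiable h (f x) ->
  'D_v (h \o f) x = 'D_('D_v f x) h (f x).
Proof.
move=> df dh; rewrite deriveE; last exact: differentiable_comp.
by rewrite diff_comp //= !deriveE.
Qed.

Lemma derive_linear V W (f : V -> W) x a u v : differentiable f x ->
  'D_(a *: u + v) f x = a *: 'D_u f x + 'D_v f x.
Proof. by move=> df; rewrite !deriveE // linearP. Qed.

Lemma derive_row_sum W n (f : 'rV[R]_n -> W) x v : differentiable f x ->
  'D_v f x = \sum_j v 0 j *: 'D_(delta_mx 0 j) f x.
Proof.
move=> df; rewrite deriveE // {1}(row_sum_delta v) linear_sum.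
by apply: eq_bigr => j _; rewrite linearZ deriveE.
Qed.

(** The chain rule differentiates [h] in the direction ['D_v f x], which moves with x, whereas [Ck]
    speaks of fixed directions. Expanding that direction in the standard basis leaves products to
    which induction applies. *)
Lemma Ck_comp V n k (U : set V) (U' : set 'rV[R]_n) (f : V -> 'rV[R]_n)
    (h : 'rV[R]_n -> R) : open U -> (forall x, U x -> U' (f x)) ->
  Ck k U f -> Ck k U' h -> Ck k U (h \o f).
Proof.
move=> oU fU; elim: k f h fU => [|k IH] f h fU.
  by move=> fc hc x Ux; apply: continuous_comp; [exact: fc|exact/hc/fU].
move=> fk1; have [fd fk] := fk1; move=> [hd hk].
split=> [x Ux|v]; first by apply: differentiable_comp; [exact: fd|exact/hd/fU].
have H j : Ck k U (fun x => 'D_v f x 0 j * 'D_(delta_mx 0 j) h (f x)).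
  apply: CkM => //; first exact/Ck_coord/fk.
  exact: (IH _ _ fU (CkW fk1) (hk _)).
have hdx x (Ux : U x) := hd _ (fU _ Ux).
apply: (eq_Ck oU _ (Ck_sum (P := xpredT) (index_enum _) oU (fun j _ => H j))).
move=> x Ux /=.
by rewrite (derive_comp _ (fd _ Ux) (hdx _ Ux)) (derive_row_sum _ (hdx _ Ux)).
Qed.

End Ck_theory.

(** * Smooth dependence of the solutions of linear systems *)

Lemma gram_unit (R : realFieldType) m n (J : 'M[R]_(m, n)) :
  (forall u : 'rV_m, u *m J = 0 -> u = 0) -> J *m J^T \in unitmx.
Proof.
move=> Jinj; rewrite -row_free_unit -kermx_eq0; apply/rowV0P => u /sub_kermxP uJ.
apply: Jinj; set w := u *m J.
(* This entry is the sum of the squares of the entries of u J, so over an ordered field u J J^T = 0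
   forces u J = 0. *)
have : (w *m w^T) 0 0 = 0 by rewrite trmx_mul mulmxA -(mulmxA u) uJ mul0mx mxE.
rewrite mxE => /eqP; rewrite (eq_bigr (fun j => w 0 j ^+ 2)); last first.
  by move=> j _; rewrite [w^T _ _]mxE expr2.
rewrite psumr_eq0; last by move=> j _; rewrite sqr_ge0.
move=> /allP w0; apply/rowP => j; rewrite [RHS]mxE.
by apply/eqP; rewrite -sqrf_eq0; apply: w0; rewrite mem_index_enum.
Qed.

Section Solve.
Context (R : realType) (V : normedModType R) (m n : nat).
Variables (k : nat) (U : set V).
Hypothesis oU : open U.

Lemma Ck_det (A : V -> 'M[R]_m) : (forall i j, Ck k U (fun x => A x i j)) ->
  Ck k U (fun x => \det (A x)).
Proof.
move=> Ak; rewrite /determinant; apply: Ck_sum => // s _.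
by apply: CkM => //; [exact: Ck_cst|exact: Ck_prod].
Qed.

Lemma Ck_mulmx p (A : V -> 'M[R]_(m, n)) (B : V -> 'M[R]_(n, p)) i j :
  (forall i j, Ck k U (fun x => A x i j)) ->
  (forall i j, Ck k U (fun x => B x i j)) ->
  Ck k U (fun x => (A x *m B x) i j).
Proof.
move=> Ak Bk.
have ABE x : U x -> \sum_l A x i l * B x l j = (A x *m B x) i j by rewrite mxE.
by apply: (eq_Ck oU ABE); apply: Ck_sum => // l _; apply: CkM.
Qed.

End Solve.

(** Cramer's rule: the entries are cofactors divided by a determinant that does not vanish on U. *)
Lemma Ck_invmx (R : realType) (V : normedModType R) m k (U : set V)
    (A : V -> 'M[R]_m) i j : open U ->
  (forall x, U x -> A x \in unitmx) ->
  (forall i j, Ck k U (fun x => A x i j)) -> Ck k U (fun x => invmx (A x) i j).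
Proof.
move=> oU Au Ak.
have AE x : U x -> (\det (A x))^-1 * ((-1) ^+ (j + i) *
    \det (row' j (col' i (A x)))) = invmx (A x) i j.
  by move=> Ux; rewrite /invmx Au // !mxE.
apply: (eq_Ck oU AE); apply: CkM => //.
  apply: CkV => //; last exact: Ck_det.
  by move=> x Ux; rewrite -unitfE -unitmxE Au.
apply: CkM => //; first exact: Ck_cst.
apply: Ck_det => // a b.
by apply: (eq_Ck oU _ (Ak (lift j a) (lift i b))) => x Ux; rewrite !mxE.
Qed.

(** An injective J has the right inverse J^T (J J^T)^-1, so y J = z gives y = z J^T (J J^T)^-1, a
    formula in which only regular functions occur. *)
Lemma Ck_solve (R : realType) (V : normedModType R) m n k (U : set V)
    (J : V -> 'M[R]_(m, n)) (y : V -> 'rV_m) (z : V -> 'rV_n) : open U ->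
  (forall x, U x -> forall u : 'rV_m, u *m J x = 0 -> u = 0) ->
  (forall x, U x -> y x *m J x = z x) ->
  (forall i j, Ck k U (fun x => J x i j)) -> Ck k U z -> Ck k U y.
Proof.
move=> oU Jinj yJ Jk zk.
have yE x : U x -> z x *m ((J x)^T *m invmx (J x *m (J x)^T)) = y x.
  move=> Ux; rewrite -yJ // -mulmxA (mulmxA (J x)) mulmxV ?mulmx1 //.
  exact/gram_unit/Jinj.
apply: (eq_Ck oU yE).
have JTk i j : Ck k U (fun x => (J x)^T i j).
  by apply: (eq_Ck oU _ (Jk j i)) => x _; rewrite mxE.
apply: Ck_row => // j; apply: Ck_mulmx => // [a b|a b]; first exact: Ck_coord.
apply: Ck_mulmx => // c d; apply: Ck_invmx => // [x Ux|e f].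
  exact/gram_unit/Jinj.
exact: Ck_mulmx.
Qed.

(** * Symmetry of second derivatives *)

Section Schwarz.
Context (R : realType) (V : normedModType R).

Lemma is_derive_line (f : V -> R) (x u : V) (s : R) :
  differentiable f (x + s *: u) ->
  is_derive s 1 (fun s => f (x + s *: u)) ('D_u f (x + s *: u)).
Proof.
move=> df.
have dl : is_diff s (fun s : R => x + s *: u) (fun s => s *: u).
  by apply: is_diff_eq; rewrite add0r.
have dfl : differentiable (f \o (fun s => x + s *: u)) s.
  exact: differentiable_comp.
apply: DeriveDef; first exact: diff_derivable dfl.
by rewrite [LHS]derive_comp // [X in 'D_X _ _]deriveE // diff_val scale1r.
Qed.

Lemma MVT_line (f : V -> R) (x u : V) (h : R) : 0 <= h ->
  (forall s, 0 <= s <= h -> differentiable f (x + s *: u)) ->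
  exists2 s, 0 <= s <= h & f (x + h *: u) - f x = 'D_u f (x + s *: u) * h.
Proof.
move=> h0 df.
have [||s] := @MVT_segment R (fun s => f (x + s *: u))
  (fun s => 'D_u f (x + s *: u)) 0 h h0.
- move=> s; rewrite in_itv /= => /andP[s0 sh]; apply: is_derive_line.
  by apply: df; rewrite !ltW.
- apply: derivable_within_continuous => s; rewrite in_itv /= => sh.
  by have [] := is_derive_line (df _ sh).
by rewrite in_itv /= scale0r addr0 subr0 => sh fE; exists s.
Qed.

(** Two mean value theorems: along u for y |-> f (y + h v) - f y, then along v for D_u f. The left
    side is symmetric in u and v, the right side is not. *)
Lemma second_difference (U : set V) (f : V -> R) (x u v : V) (h : R) :
  0 <= h -> Ck 2 U f ->
  (forall s t, 0 <= s <= h -> 0 <= t <= h -> U (x + s *: u + t *: v)) ->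
  exists s t, [/\ 0 <= s <= h, 0 <= t <= h &
    f (x + h *: u + h *: v) - f (x + h *: u) - f (x + h *: v) + f x =
    'D_v ('D_u f) (x + s *: u + t *: v) * h ^+ 2].
Proof.
move=> h0 [fd /(_ u)[fud _]] Ust.
have hh : 0 <= h <= h by apply/andP.
have h00 : (0 <= 0 :> R) && (0 <= h) by rewrite lexx h0.
have Us s : 0 <= s <= h -> U (x + s *: u).
  by move=> sh; have := Ust s 0 sh h00; rewrite scale0r addr0.
pose phi y := f (y + h *: v) - f y.
have dphi s : 0 <= s <= h -> differentiable (fun y => f (y + h *: v)) (x + s *: u).
  move=> sh; apply: (@differentiable_comp _ _ _ _ (fun y => y + h *: v) f) => //.
  exact/fd/Ust.
have [s sh phiE] : exists2 s, 0 <= s <= h &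
    phi (x + h *: u) - phi x = 'D_u phi (x + s *: u) * h.
  apply: MVT_line => // s sh; apply: differentiableB; first exact: dphi.
  exact/fd/Us.
have [t th fuE] := @MVT_line ('D_u f) (x + s *: u) v h h0
  (fun t th => fud _ (Ust s t sh th)).
exists s, t; split => //.
transitivity (phi (x + h *: u) - phi x); first by rewrite /phi; ring.
rewrite phiE expr2 mulrA -fuE; congr (_ * _).
rewrite deriveB; last 2 first.
- exact/diff_derivable/dphi.
- exact/diff_derivable/fd/Us.
congr (_ - _).
rewrite (@derive_comp _ _ _ _ (fun y => y + h *: v) f) //; last exact/fd/Ust.
by congr ('D__ _ _); rewrite deriveD // derive_cst derive_id addr0.
Qed.

Lemma dist_le (a b c e : R) :
  `|a - c| < e / 2 -> `|b - c| < e / 2 -> a <= b + e.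
Proof. by rewrite !ltr_norml => /andP[a1 a2] /andP[b1 b2]; lra. Qed.

Lemma continuous_dist_lt (f : V -> R) (x : V) (e : R) : 0 < e ->
  {for x, continuous f} -> nbhs x [set y | `|f x - f y| < e].
Proof. by move=> e0 /cvgrPdist_lt; apply. Qed.

(** Schwarz's theorem: one second difference, computed in both orders, equates the two mixed
    derivatives at two points near x, and their continuity brings the equality to x. By exchanging u
    and v an inequality suffices. *)
Lemma derive_sym (U : set V) (f : V -> R) (x u v : V) : open U -> U x ->
  Ck 2 U f -> 'D_u ('D_v f) x = 'D_v ('D_u f) x.
Proof.
move=> oU Ux fk.
have cont w w' : {for x, continuous ('D_w ('D_w' f))}.
  by have [_ /(_ w')[_ /(_ w)]] := fk; apply.
apply/eqP; rewrite eq_le; apply/andP.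
have key (u' v' : V) : 'D_u' ('D_v' f) x <= 'D_v' ('D_u' f) x.
  apply/ler_addgt0Pr => e e0; have e20 : 0 < e / 2 by rewrite divr_gt0.
  have : nbhs x (U `&` ([set y | `|'D_u' ('D_v' f) x - 'D_u' ('D_v' f) y| < e / 2]
      `&` [set y | `|'D_v' ('D_u' f) x - 'D_v' ('D_u' f) y| < e / 2])).
    apply: filterI; first exact: open_nbhs_nbhs.
    by apply: filterI; exact: continuous_dist_lt.
  move=> /nbhs_ballP[r /= r0 rU].
  (* The added 1 makes N positive even if both vectors vanish, and gives h (|u'| + |v'|) < h N = r,
     so the whole parallelogram stays in the ball. *)
  pose N := `|u'| + `|v'| + 1.
  have N0 : 0 < N by rewrite ltr_wpDl // addr_ge0.
  pose h := r / N.
  have h0 : 0 < h by rewrite divr_gt0.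
  have ball_st s t : 0 <= s <= h -> 0 <= t <= h ->
      ball x r (x + s *: u' + t *: v').
    move=> /andP[s0 sh] /andP[t0 th].
    rewrite -ball_normE /= -addrA opprD addrA subrr add0r normrN.
    apply: le_lt_trans (ler_normD _ _) _; rewrite !normrZ !ger0_norm //.
    have -> : r = h * N by rewrite /h divfK // gt_eqF.
    rewrite /N.
    have : s * `|u'| <= h * `|u'| by rewrite ler_wpM2r.
    have : t * `|v'| <= h * `|v'| by rewrite ler_wpM2r.
    by rewrite !mulrDr mulr1; lra.
  have ball_ts s t : 0 <= s <= h -> 0 <= t <= h ->
      ball x r (x + s *: v' + t *: u').
    by move=> sh th; rewrite addrAC; exact: ball_st.
  have [s [t [sh th E1]]] := second_difference (ltW h0) fk
    (fun s t sh th => let: conj Uy _ := rU _ (ball_st s t sh th) in Uy).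
  have [s' [t' [sh' th' E2]]] := second_difference (ltW h0) fk
    (fun s t sh th => let: conj Uy _ := rU _ (ball_ts s t sh th) in Uy).
  have [_ [_ B1]] := rU _ (ball_st _ _ sh th).
  have [_ [A1 _]] := rU _ (ball_ts _ _ sh' th').
  have AB : 'D_v' ('D_u' f) (x + s *: u' + t *: v') =
      'D_u' ('D_v' f) (x + s' *: v' + t' *: u').
    apply: (mulIf (lt0r_neq0 (exprn_gt0 2 h0))).
    apply: etrans (esym E1) (etrans _ E2).
    by rewrite [x + h *: v' + _]addrAC; congr (_ + f x); exact: addrAC.
  apply: dist_le A1 _; rewrite -AB; exact: B1.
by split; exact: key.
Qed.

End Schwarz.

(** * Maps between manifolds in charts *)

Section Local_representatives.
Context (R : realType).

Lemma scalar_sum (V : lmodType R) (a : V -> R) (I : Type) (r : seq I)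
    (x : I -> R) (w : I -> V) : scalar a ->
  a (\sum_(j <- r) x j *: w j) = \sum_(j <- r) x j * a (w j).
Proof.
move=> la; elim: r => [|j r IH]; last by rewrite !big_cons la IH.
rewrite !big_nil; have := la (-1) 0 0.
by rewrite scaler0 addr0 mulN1r addNr.
Qed.

Lemma linear_fun_sum (V W : lmodType R) (f : V -> W) (I : Type) (r : seq I)
    (x : I -> R) (w : I -> V) : linear f ->
  f (\sum_(j <- r) x j *: w j) = \sum_(j <- r) x j *: f (w j).
Proof.
move=> lf; elim: r => [|j r IH]; last by rewrite !big_cons lf IH.
rewrite !big_nil; have := lf (-1) 0 0.
by rewrite scaler0 addr0 scaleN1r addNr.
Qed.

Lemma linear_fun0 (V W : lmodType R) (f : V -> W) : linear f -> f 0 = 0.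
Proof.
by move=> lf; have := lf (-1) 0 0; rewrite scaler0 addr0 scaleN1r addNr.
Qed.

Lemma linear_funN (V W : lmodType R) (f : V -> W) v : linear f -> f (- v) = - f v.
Proof.
by move=> lf; have := lf (-1) v 0; rewrite (linear_fun0 lf) !addr0 !scaleN1r.
Qed.

Lemma chart_open n (M : manifold R n) (c : atlas M) (A : set M) :
  open A -> A `<=` dom c -> open (chart c @` A).
Proof.
move=> oA Ac; rewrite openE => _ [p Ap <-].
have Up : (chart c @` dom c) (chart c p) by exists p => //; exact: Ac.
have nU : nbhs (chart c p) (chart c @` dom c).
  by apply: open_nbhs_nbhs; split => //; exact: chart_image_open.
have nA : nbhs (chart c p) (param c @^-1` A).
  apply: (param_continuous Up); rewrite chartK; last exact: Ac.
  exact: open_nbhs_nbhs.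
apply: filterS (filterI nU nA) => _ [[q cq <-] /=]; rewrite chartK // => Aq.
by exists q.
Qed.

Section Map.
Context (m n : nat) (L : manifold R m) (M : manifold R n) (i : L -> M).

Definition overlap (c : atlas L) (d : atlas M) : set 'rV[R]_m :=
  chart c @` (dom c `&` i @^-1` dom d).

Definition local_rep (c : atlas L) (d : atlas M) : 'rV[R]_m -> 'rV[R]_n :=
  chart d \o i \o param c.

Hypothesis i_smooth : smooth_map i.

Lemma overlap_open c d : open (overlap c d).
Proof.
apply: chart_open; last by move=> q [].
apply: openI; first exact: dom_open.
by case: i_smooth => /continuousP ic _; exact/ic/dom_open.
Qed.

Lemma overlap_chart c d q : dom c q -> dom d (i q) -> overlap c d (chart c q).
Proof. by move=> cq dq; exists q. Qed.

Lemma local_rep_smooth c d k : Ck k (overlap c d) (local_rep c d).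
Proof. by case: i_smooth => _; exact. Qed.

Lemma local_rep_diff c d q : dom c q -> dom d (i q) ->
  differentiable (local_rep c d) (chart c q).
Proof.
move=> cq dq; have [df _] := local_rep_smooth c d 1.
exact/df/overlap_chart.
Qed.

Lemma near_overlap c d q : dom c q -> dom d (i q) ->
  nbhs (chart c q) (overlap c d).
Proof.
move=> cq dq; apply: open_nbhs_nbhs; split; first exact: overlap_open.
exact: overlap_chart.
Qed.

Lemma smooth_in_chart_local (W : normedModType R) (c : atlas L) (f : L -> W) :
  (forall d k, Ck k (overlap c d) (f \o param c)) -> smooth_in_chart c f.
Proof.
move=> fk k; apply: Ck_local => _ [q cq <-].
exists (overlap c (chart_at (i q))) => //.
by apply: overlap_chart => //; exact: dom_chart_at.
Qed.

Lemma Ck_pullback c d k (f : M -> R) : smooth_in_chart d f ->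
  Ck k (overlap c d) (f \o i \o param c).
Proof.
move=> fd.
have fE x : overlap c d x -> ((f \o param d) \o local_rep c d) x =
    (f \o i \o param c) x.
  by move=> [q [cq dq] <-]; rewrite /local_rep /= !chartK // chartK.
have oU : open (overlap c d) by exact: overlap_open.
apply: (eq_Ck oU fE); apply: (Ck_comp oU _ _ (fd k)).
  move=> _ [q [cq dq] <-]; exists (i q) => //.
  by rewrite /local_rep /= chartK.
exact: local_rep_smooth.
Qed.

Lemma derive_local_rep_sum c d x v : overlap c d x ->
  'D_v (local_rep c d) x = \sum_j v 0 j *: 'D_(delta_mx 0 j) (local_rep c d) x.
Proof. by move=> [q [cq dq] <-]; exact/derive_row_sum/local_rep_diff. Qed.

Lemma tangent_map_linear q : linear (@tangent_map R m n L M i q).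
Proof.
move=> a u v; apply: derive_linear.
by apply: (@local_rep_diff (chart_at q)); exact: dom_chart_at.
Qed.

End Map.

(** Turns every result on [local_rep] into one on the transition maps of M. *)
Lemma id_smooth n (M : manifold R n) : smooth_map (idfun : M -> M).
Proof. by split=> [x|c d]; [exact: cvg_id|exact: transition_smooth]. Qed.

Section Chain.
Context (m n : nat) (L : manifold R m) (M : manifold R n) (i : L -> M).
Hypothesis i_smooth : smooth_map i.

Lemma local_rep_source c c' d q v : dom c q -> dom c' q -> dom d (i q) ->
  'D_('D_v (chart c' \o param c) (chart c q)) (local_rep i c' d) (chart c' q) =
  'D_v (local_rep i c d) (chart c q).
Proof.
move=> cq c'q dq.
have dT := local_rep_diff (@id_smooth _ L) cq c'q.
have pE : (chart c' \o param c) (chart c q) = chart c' q by rewrite /= chartK.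
have dF : differentiable (local_rep i c' d) ((chart c' \o param c) (chart c q)).
  by rewrite pE; exact: local_rep_diff.
have := @derive_comp _ _ _ _ (chart c' \o param c) _ _ v dT dF; rewrite pE => <-.
apply: near_eq_derive.
apply: filterS (near_overlap (@id_smooth _ L) cq c'q) => _ [p [cp c'p] <-].
by rewrite /local_rep /= !chartK.
Qed.

Lemma local_rep_target c d d' q v : dom c q -> dom d (i q) -> dom d' (i q) ->
  'D_('D_v (local_rep i c d) (chart c q)) (chart d' \o param d) (chart d (i q)) =
  'D_v (local_rep i c d') (chart c q).
Proof.
move=> cq dq d'q.
have dT := local_rep_diff (@id_smooth _ M) dq d'q.
have dF := local_rep_diff i_smooth cq dq.
have pE : local_rep i c d (chart c q) = chart d (i q).
  by rewrite /local_rep /= chartK.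
have dT' : differentiable (chart d' \o param d) (local_rep i c d (chart c q)).
  by rewrite pE.
have := derive_comp v dF dT'; rewrite pE => <-.
apply: near_eq_derive.
apply: filterS (near_overlap i_smooth cq dq) => _ [p [cp dp] <-].
by rewrite /local_rep /= !chartK.
Qed.

(** [tangent_map] is defined through preferred charts; the chain rule at the source and at the
    target shows that the Jacobian in any two charts computes it. *)
Lemma tangent_map_coord_vec c d q v : dom c q -> dom d (i q) ->
  tangent_map i (coord_vec c q v) =
  coord_vec d (i q) ('D_v (local_rep i c d) (chart c q)).
Proof.
move=> cq dq; rewrite [RHS]local_rep_target //; last exact: dom_chart_at.
by apply: local_rep_source => //; exact: dom_chart_at.
Qed.

End Chain.

Section Frames.
Context (n : nat) (M : manifold R n).

Lemma coord_vec_linear (c : atlas M) p : dom c p -> linear (coord_vec c p).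
Proof.
move=> cp a u v; apply: derive_linear.
have dT := local_rep_diff (@id_smooth _ M) cp (dom_chart_at p).
exact: dT.
Qed.

Lemma components_linear (c : atlas M) p : dom c p -> linear (@components R n M c p).
Proof.
move=> cp a u v; apply: derive_linear.
have dT := local_rep_diff (@id_smooth _ M) (dom_chart_at p) cp.
exact: dT.
Qed.

Lemma derive_transition_id (c : atlas M) p v : dom c p ->
  'D_v (local_rep idfun c c) (chart c p) = v.
Proof.
move=> cp; rewrite -[RHS](derive_id (chart c p)); apply: near_eq_derive.
apply: filterS (near_overlap (@id_smooth _ M) cp cp) => _ [q [cq _] <-].
by rewrite /local_rep /= chartK.
Qed.

(** The transitions from [c] to the preferred chart and back compose to the identity near the
    point. *)
Lemma coord_vecK (c : atlas M) p : dom c p ->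
  cancel (coord_vec c p) (@components R n M c p).
Proof.
move=> cp v; rewrite -[RHS](derive_transition_id v cp).
exact: (local_rep_source (@id_smooth _ M) v cp (dom_chart_at p) cp).
Qed.

Lemma componentsK (c : atlas M) p : dom c p ->
  cancel (@components R n M c p) (coord_vec c p).
Proof.
move=> cp v; rewrite -[RHS](derive_transition_id v (dom_chart_at p)).
exact: (local_rep_source (@id_smooth _ M) v (dom_chart_at p) cp (dom_chart_at p)).
Qed.

End Frames.

Section Pullback.
Context (m n : nat) (L : manifold R m) (M : manifold R n) (i : L -> M).
Hypothesis i_smooth : smooth_map i.

(** The form in which smoothness and derivatives of a pullback are computed: Jacobian entries times
    the coefficients of [a] along fixed coordinate fields of [d]. *)
Lemma pullback1E (a : forall p : M, tangent p -> R) c d x v :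
  (forall p, scalar (a p)) -> overlap i c d x ->
  pullback1 i a (param c x) (coord_vec c (param c x) v) =
  \sum_j 'D_v (local_rep i c d) x 0 j *
    a (i (param c x)) (coord_vec d (i (param c x)) (delta_mx 0 j)).
Proof.
move=> la [q [cq dq] <-]; rewrite chartK //.
rewrite /pullback1 (tangent_map_coord_vec i_smooth v cq dq).
rewrite {1}(row_sum_delta ('D_v _ _)).
by rewrite (linear_fun_sum _ _ _ (coord_vec_linear dq)) (scalar_sum _ _ _ (la _)).
Qed.

Lemma pullback1_one_form (a : forall p : M, tangent p -> R) :
  one_form a -> one_form (pullback1 i a).
Proof.
move=> [la ak]; split=> [q k u v|c v].
  by rewrite /pullback1 tangent_map_linear ?la.
apply: smooth_in_chart_local => d k; have oU := overlap_open i_smooth (c := c) (d := d).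
apply: (eq_Ck oU (fun x Ux => esym (pullback1E v la Ux))).
apply: Ck_sum => // j _; apply: CkM => //; last first.
  exact: (Ck_pullback i_smooth c k (ak d (delta_mx 0 j))).
apply: Ck_coord => //.
by have [_ /(_ v)] := local_rep_smooth i_smooth c d k.+1.
Qed.

End Pullback.

End Local_representatives.

(** * Pullbacks of forms and metrics *)

Section Pullback_derivative.
Context (R : realType).

Lemma derive_sum_mul (V : normedModType R) n (f g : 'I_n -> V -> R) x u :
  (forall j, differentiable (f j) x) -> (forall j, differentiable (g j) x) ->
  'D_u (fun y => \sum_j f j y * g j y) x =
  \sum_j (f j x * 'D_u (g j) x + g j x * 'D_u (f j) x).
Proof.
move=> df dg.
have -> : (fun y => \sum_j f j y * g j y) = \sum_j (f j * g j).
  by apply/funext => y; rewrite fct_sumE.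
rewrite derive_sum; last first.
  by move=> j; apply/diff_derivable/differentiableM.
by apply: eq_bigr => j _; rewrite deriveM //; exact: diff_derivable.
Qed.

Lemma derive_sym_row (V : normedModType R) n (U : set V) (f : V -> 'rV[R]_n)
    (x u v : V) j : open U -> U x -> Ck 2 U f ->
  'D_u ('D_v f) x 0 j = 'D_v ('D_u f) x 0 j.
Proof.
move=> oU Ux fk; have [fd fk'] := fk.
have dE w w' : 'D_w ('D_w' (fun y => f y 0 j)) x = 'D_w ('D_w' f) x 0 j.
  have [/(_ x Ux) df' _] := fk' w'.
  rewrite -derive_coord //; apply: near_eq_derive.
  apply: filterS (open_nbhs_nbhs (conj oU Ux)) => y Uy.
  by rewrite derive_coord //; exact: fd.
apply: etrans (esym (dE u v)) (etrans _ (dE v u)).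
by apply: derive_sym Ux _ => //; exact: Ck_coord.
Qed.

Context (m n : nat) (L : manifold R m) (M : manifold R n) (i : L -> M).
Hypothesis i_smooth : smooth_map i.

Lemma derive_coefficient (a : forall p : M, tangent p -> R) d p u v :
  one_form a -> dom d p ->
  'D_u (fun y => a (param d y) (coord_vec d (param d y) v)) (chart d p) =
  \sum_j v 0 j *
    'D_u (fun y => a (param d y) (coord_vec d (param d y) (delta_mx 0 j)))
      (chart d p).
Proof.
move=> [la ak] dp.
have nU : nbhs (chart d p) (chart d @` dom d).
  by apply: open_nbhs_nbhs; split; [exact: chart_image_open|exists p].
pose B j y := a (param d y) (coord_vec d (param d y) (delta_mx 0 j)).
rewrite (@near_eq_derive _ _ _ _ (fun y => \sum_j cst (v 0 j) y * B j y)).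
  rewrite derive_sum_mul.
  - by apply: eq_bigr => j _; rewrite derive_cst mulr0 addr0.
  - by move=> j; exact: differentiable_cst.
  - move=> j; have [/(_ (chart d p)) dB _] := ak d (delta_mx 0 j) 1.
    by apply: dB; exists p.
apply: filterS nU => _ [q dq <-] /=; rewrite /B chartK //.
rewrite {1}(row_sum_delta v) (linear_fun_sum _ _ _ (coord_vec_linear dq)).
by rewrite (scalar_sum _ _ _ (la _)).
Qed.

(** Product rule for [pullback1E]. Antisymmetrized in u and v, the first term becomes the value of
    da on the images; the sum carries the second derivatives of i and is symmetric. *)
Lemma derive_pullback_coefficient (a : forall p : M, tangent p -> R) c d q u v :
  one_form a -> dom c q -> dom d (i q) ->
  'D_u (fun x => pullback1 i a (param c x) (coord_vec c (param c x) v))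
    (chart c q) =
  'D_('D_u (local_rep i c d) (chart c q))
     (fun y => a (param d y)
       (coord_vec d (param d y) ('D_v (local_rep i c d) (chart c q))))
     (chart d (i q)) +
  \sum_j a (i q) (coord_vec d (i q) (delta_mx 0 j)) *
    'D_u ('D_v (local_rep i c d)) (chart c q) 0 j.
Proof.
move=> fa cq dq; have [la ak] := fa.
pose F := local_rep i c d.
pose B j y := a (param d y) (coord_vec d (param d y) (delta_mx 0 j)).
have FE : F (chart c q) = chart d (i q) by rewrite /F /local_rep /= chartK.
have dB j : differentiable (B j) (F (chart c q)).
  have [/(_ (chart d (i q))) dB _] := ak d (delta_mx 0 j) 1.
  by rewrite FE; apply: dB; exists (i q).
have BE j : B j (F (chart c q)) = a (i q) (coord_vec d (i q) (delta_mx 0 j)).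
  by rewrite FE /B chartK.
have dF : differentiable F (chart c q) := local_rep_diff i_smooth cq dq.
have dFv : differentiable ('D_v F) (chart c q).
  have [_ /(_ v)[dFv _]] := local_rep_smooth i_smooth c d 2.
  exact/dFv/overlap_chart.
rewrite (@near_eq_derive _ _ _ _ (fun x => \sum_j 'D_v F x 0 j * (B j \o F) x)).
  rewrite derive_sum_mul.
  - rewrite (derive_coefficient _ _ fa dq) big_split /=.
    apply: f_equal2.
      apply: eq_bigr => j _.
      by rewrite (derive_comp _ dF (dB j)) FE.
    apply: eq_bigr => j _.
    by rewrite (derive_coord _ _ _ dFv) BE.
  - move=> j.
    apply: (@differentiable_comp _ _ _ _ _ (fun N : 'rV[R]_n => N 0 j)) dFv _.
    exact: differentiable_coord.
  - by move=> j; exact: (differentiable_comp dF (dB j)).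
apply: filterS (near_overlap i_smooth cq dq) => x Ux.
rewrite (pullback1E i_smooth v la Ux); apply: eq_bigr => j _; congr (_ * _).
have [p [cp dp] <-] := Ux.
by rewrite /B /F /local_rep /= !chartK // chartK.
Qed.

(* d(i^*a) = i^*(da): the second derivatives of i cancel by symmetry. *)
Lemma ext_deriv_pullback1 (a : forall p : M, tangent p -> R) q (u v : tangent q) :
  one_form a ->
  ext_deriv (pullback1 i a) u v =
  ext_deriv a (tangent_map i u) (tangent_map i v).
Proof.
move=> fa; rewrite /ext_deriv /=.
have [cq dq] := (dom_chart_at q, dom_chart_at (i q)).
apply: etrans (f_equal2 (fun x y => x - y)
  (derive_pullback_coefficient u v fa cq dq)
  (derive_pullback_coefficient v u fa cq dq)) _.
rewrite opprD addrACA -[RHS]addr0; congr (_ + _).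
rewrite -sumrB big1 // => j _.
apply/eqP; rewrite subr_eq0; apply/eqP; apply: f_equal.
have oU : open (overlap i (chart_at q) (chart_at (i q))) by exact: overlap_open.
exact: derive_sym_row oU (overlap_chart cq dq) (local_rep_smooth i_smooth _ _ 2).
Qed.

Lemma components_tangent_map c d q (w : tangent q) : dom c q -> dom d (i q) ->
  components d (tangent_map i w) =
  'D_(components c w) (local_rep i c d) (chart c q).
Proof.
move=> cq dq; rewrite -{1}(componentsK cq w) (tangent_map_coord_vec i_smooth _ cq dq).
exact: coord_vecK.
Qed.

Lemma smooth_of_tangent_map (Y : forall q : L, tangent q) c :
  (forall q, injective (@tangent_map R m n L M i q)) ->
  (forall d k, Ck k (overlap i c d)
     (fun x => components d (tangent_map i (Y (param c x))))) ->
  smooth_in_chart c (fun q => components c (Y q)).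
Proof.
move=> i_inj Yk; apply: smooth_in_chart_local => d k.
have oU : open (overlap i c d) by exact: overlap_open.
pose F := local_rep i c d.
pose J x := \matrix_(l < m, j < n) 'D_(delta_mx 0 l) F x 0 j.
have JE x w : overlap i c d x -> w *m J x = 'D_w F x.
  move=> Ux; rewrite derive_local_rep_sum //; apply/rowP => j.
  by rewrite mxE summxE; apply: eq_bigr => l _; rewrite !mxE.
apply: (Ck_solve (J := J)
  (z := fun x => components d (tangent_map i (Y (param c x)))) oU) => //.
- move=> x Ux w; rewrite JE // => Fw0; have [q [cq dq] xE] := Ux.
  (* Injectivity is given in the preferred charts; the invertible maps [coord_vec] transfer it to
     the Jacobian in [c] and [d]. *)
  have tq : tangent_map i (coord_vec c q w) = tangent_map i 0.
    rewrite (tangent_map_coord_vec i_smooth _ cq dq) xE Fw0.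
    by rewrite !linear_fun0 //; [exact: tangent_map_linear|exact: coord_vec_linear].
  by rewrite -(coord_vecK cq w) (i_inj _ _ _ tq) linear_fun0 //; exact: components_linear.
- move=> x Ux; rewrite JE //; have [q [cq dq] <-] := Ux.
  by rewrite /= chartK // (components_tangent_map (Y q) cq dq).
- move=> l j; have [_ /(_ (delta_mx 0 l)) Fk] := local_rep_smooth i_smooth c d k.+1.
  apply: (eq_Ck oU _ (Ck_coord 0 j oU Fk)) => x _.
  by rewrite mxE.
Qed.

Lemma pullback2E (g : forall p : M, tangent p -> tangent p -> R) c d x u v :
  (forall p u, scalar (g p u)) -> (forall p u v, g p u v = g p v u) ->
  overlap i c d x ->
  pullback2 i g (param c x) (coord_vec c (param c x) u) (coord_vec c (param c x) v) =
  \sum_j \sum_l 'D_v (local_rep i c d) x 0 j * ('D_u (local_rep i c d) x 0 l *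
    g (i (param c x)) (coord_vec d (i (param c x)) (delta_mx 0 j))
      (coord_vec d (i (param c x)) (delta_mx 0 l))).
Proof.
move=> lg sg [q [cq dq] <-]; rewrite chartK //.
rewrite /pullback2 !(tangent_map_coord_vec i_smooth _ cq dq).
rewrite {1}(row_sum_delta ('D_v _ _)) (linear_fun_sum _ _ _ (coord_vec_linear dq)).
rewrite (scalar_sum _ _ _ (lg _ _)); apply: eq_bigr => j _.
rewrite sg {1}(row_sum_delta ('D_u _ _)) (linear_fun_sum _ _ _ (coord_vec_linear dq)).
by rewrite (scalar_sum _ _ _ (lg _ _)) mulr_sumr.
Qed.

Lemma pullback2_riemannian (g : forall p : M, tangent p -> tangent p -> R) :
  (forall q, injective (@tangent_map R m n L M i q)) ->
  riemannian_metric g -> riemannian_metric (pullback2 i g).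
Proof.
move=> i_inj [lg sg pg gk]; split.
- by move=> q u a v w; rewrite /pullback2 tangent_map_linear ?lg.
- by move=> q u v; exact: sg.
- move=> q v v0; apply: pg; apply: contra_neq v0 => tv0; apply: i_inj.
  by rewrite tv0 linear_fun0 //; exact: tangent_map_linear.
move=> c u v; apply: smooth_in_chart_local => d k.
have oU : open (overlap i c d) by exact: overlap_open.
apply: (eq_Ck oU (fun x Ux => esym (pullback2E u v lg sg Ux))).
have DFk w j : Ck k (overlap i c d) (fun x => 'D_w (local_rep i c d) x 0 j).
  apply: Ck_coord => //.
  by have [_ /(_ w)] := local_rep_smooth i_smooth c d k.+1.
apply: Ck_sum => // j _; apply: Ck_sum => // l _; do 2!apply: CkM => //.
exact: (Ck_pullback i_smooth c k (gk d (delta_mx 0 j) (delta_mx 0 l))).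
Qed.

End Pullback_derivative.

(** * Positivity of the contact volume form *)

(** Here [t] is [s] with 0 deleted from the source and [s ord0] from the target; sums over
    permutations thus reduce to smaller ones with a known sign. *)
Lemma lift_perm_ord0 n (s : 'S_n.+1) :
  exists t : 'S_n, s = lift_perm ord0 (s ord0) t.
Proof.
(* The default [k] is never reached, since [s] takes the value [s ord0] only at 0. *)
pose f k := odflt k (unlift (s ord0) (s (lift ord0 k))).
have fE k : lift (s ord0) (f k) = s (lift ord0 k).
  rewrite /f; case: unliftP => [j -> //|/perm_inj/eqP].
  by rewrite eq_sym (negbTE (neq_lift _ _)).
have f_inj : injective f.
  by move=> j k fjk; apply: (@lift_inj _ ord0); apply: (@perm_inj _ s);
    rewrite -!fE fjk.
exists (perm f_inj); apply/permP => k; case: (unliftP ord0 k) => [j ->|->].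
  by rewrite lift_perm_lift permE fE.
by rewrite lift_perm_id.
Qed.

Section Wedge_positivity.
Context (R : realType) (V : lmodType R).

(** Antisymmetry does not come from [a] and [b]: the sum runs over the whole group, and
    multiplication by [t] reindexes it. *)
Lemma wedge_perm p q (a : ('I_p -> V) -> R) (b : ('I_q -> V) -> R)
    (v : 'I_(p + q) -> V) (t : 'S_(p + q)) :
  wedge a b (fun i => v (t i)) = (-1) ^+ t * wedge a b v.
Proof.
rewrite /wedge mulrCA; congr (_ * _); rewrite mulr_sumr.
rewrite [RHS](reindex_inj (mulIg t)) /=; apply: eq_bigr => s _.
rewrite odd_permM signr_addb [RHS]mulrA.
rewrite [(-1) ^+ t * _]mulrCA -signr_addb addbb mulr1.
congr (_ * (a _ * b _)); apply/funext => i; by rewrite permM.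
Qed.

Lemma wedge_exp_perm p (a : ('I_p -> V) -> R) k (v : 'I_(k * p) -> V)
    (t : 'S_(k * p)) :
  wedge_exp a k (fun i => v (t i)) = (-1) ^+ t * wedge_exp a k v.
Proof.
case: k v t => [|k] v t; last exact: wedge_perm.
have -> : t = 1%g by apply/permP => -[].
by rewrite odd_perm1 mul1r.
Qed.

(** The list x_0, y_0, x_1, y_1, ... Indexing by [nat] makes the deletion of a pair a composition
    with [bump], without casts between ordinals. *)
Definition pairs (x y : nat -> V) (a : nat) : V :=
  if odd a then y a./2 else x a./2.

(** The relations of a symplectic basis. Both orders of x and y are listed because [w] is an
    arbitrary function, not assumed antisymmetric. *)
Definition darboux (w : V -> V -> R) (x y : nat -> V) (k : nat) : Prop :=
  forall i j, (i < k)%N -> (j < k)%N ->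
  [/\ w (x i) (y j) = (i == j)%:R, w (y j) (x i) = - (i == j)%:R,
      w (x i) (x j) = 0 & w (y i) (y j) = 0].

Lemma darboux_bump w x y k i : (i < k.+1)%N -> darboux w x y k.+1 ->
  darboux w (x \o bump i) (y \o bump i) k.
Proof.
move=> ik wxy j l jk lk /=.
have -> : (j == l) = (bump i j == bump i l) by rewrite /bump; lia.
by apply: wxy; rewrite /bump; lia.
Qed.

(** Deleting the value a, and then a + 1, which has become a, multiplies the sign twice by (-1)^a;
    hence the remaining permutation [t] has the sign of [s]. As a is even, skipping both values
    preserves parities and skips the pair of index a/2. Antisymmetry then produces the sign of [t] a
    second time. *)
Lemma wedge_exp_even_perm w x y k (s : 'S_(k.+1 * 2)) (a : 'I_(k.+1 * 2)) :
  (forall x y, darboux w x y k ->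
    0 < wedge_exp (form2 w) k (fun j : 'I_(k * 2) => pairs x y j)) ->
  darboux w x y k.+1 -> ~~ odd a -> s (lshift (k * 2) (ord0 : 'I_2)) = a ->
  s (lshift (k * 2) (ord_max : 'I_2)) = a.+1 :> nat ->
  0 < (-1) ^+ s *
    wedge_exp (form2 w) k (fun j : 'I_(k * 2) => pairs x y (s (rshift 2 j))).
Proof.
move=> IH wxy a_even s0 s1.
have l0 : lshift (k * 2) (ord0 : 'I_2) = ord0 by apply: val_inj.
have [t1 st1] := lift_perm_ord0 (s : 'S_(k * 2).+2).
have [t t1t] := lift_perm_ord0 t1.
have sa : s ord0 = a by rewrite -s0 l0.
have s_lift (j : 'I_(k * 2).+1) : s (lift ord0 j) = bump a (t1 j) :> nat.
  by rewrite [in LHS]st1 lift_perm_lift sa.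
have t1a : t1 ord0 = a :> nat.
  have := s_lift ord0.
  have -> : lift ord0 ord0 = lshift (k * 2) (ord_max : 'I_2) by apply: val_inj.
  by rewrite s1 /bump; lia.
have sgn : s = t :> bool.
  by rewrite {1}st1 odd_lift_perm {1}t1t odd_lift_perm sa t1a /= addbA addbb.
have sE (j : 'I_(k * 2)) :
    pairs x y (s (rshift 2 j)) = pairs (x \o bump a./2) (y \o bump a./2) (t j).
  have -> : rshift 2 j = lift ord0 (lift ord0 j) by apply: val_inj.
  rewrite s_lift {1}t1t lift_perm_lift /= t1a /pairs /=.
  have -> : odd (bump a (bump a (t j))) = odd (t j) by rewrite /bump; lia.
  by have -> : ((bump a (bump a (t j)))./2 = bump a./2 (t j)./2)%N
    by rewrite /bump; lia.
rewrite (funext sE) (@wedge_exp_perm 2 (form2 w) k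
  (fun j => pairs (x \o bump a./2) (y \o bump a./2) j)).
rewrite sgn mulrA -signr_addb addbb mul1r; apply: IH.
apply: darboux_bump => //.
by have := ltn_ord a; lia.
Qed.

(* Every permutation contributes a nonnegative term: a nonzero one maps the
   first two indices to a pair {2i, 2i+1}, so that, up to the transposition of
   these two indices, it is the product of an even permutation and one of the
   remaining indices. *)
Lemma wedge_exp_darboux_gt0 w x y k : darboux w x y k ->
  0 < wedge_exp (form2 w) k (fun j : 'I_(k * 2) => pairs x y j).
Proof.
elim: k x y => [|k IH] x y wxy; first exact: ltr01.
pose o0 : 'I_(k.+1 * 2) := lshift (k * 2) (ord0 : 'I_2).
pose o1 : 'I_(k.+1 * 2) := lshift (k * 2) (ord_max : 'I_2).
have o01 : o0 != o1 by [].
have idx (b : 'I_(k.+1 * 2)) : (b./2 < k.+1)%N by have := ltn_ord b; lia.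
pose T (s : 'S_(k.+1 * 2)) := (-1) ^+ s * (w (pairs x y (s o0)) (pairs x y (s o1)) *
  wedge_exp (form2 w) k (fun j : 'I_(k * 2) => pairs x y (s (rshift 2 j)))).
have T_even (s : 'S_(k.+1 * 2)) (b : 'I_(k.+1 * 2)) : ~~ odd b ->
    s o0 = b -> s o1 = b.+1 :> nat -> 0 < T s.
  move=> b_even sb0 sb1; rewrite /T sb0 sb1 /pairs (negbTE b_even) /= b_even.
  have -> : (uphalf b = b./2)%N by lia.
  have [-> _ _ _] := wxy _ _ (idx b) (idx b).
  by rewrite eqxx mul1r; exact: wedge_exp_even_perm sb1.
suff : 0 < \sum_s T s.
  move=> sT; rewrite [wedge_exp _ _ _]/(wedge _ _ _) /wedge.
  apply: mulr_gt0; last exact: sT.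
  by rewrite invr_gt0 ltr0n muln_gt0 !fact_gt0.
rewrite (bigD1 (1%g : 'S_(k.+1 * 2))) //= ltr_wpDr //; last first.
  by apply: (T_even _ o0); rewrite ?perm1.
apply: sumr_ge0 => s _.
have ab : s o0 != s o1 by rewrite (inj_eq perm_inj).
have [hab|hab] := eqVneq (s o0)./2 (s o1)./2; last first.
  rewrite /T /pairs.
  have [w1 _ w3 w4] := wxy _ _ (idx (s o0)) (idx (s o1)).
  have [_ w2 _ _] := wxy _ _ (idx (s o1)) (idx (s o0)).
  case: (odd (s o0)); case: (odd (s o1)); rewrite ?w1 ?w2 ?w3 ?w4.
  - by rewrite mul0r mulr0.
  - by rewrite eq_sym (negbTE hab) oppr0 mul0r mulr0.
  - by rewrite (negbTE hab) mul0r mulr0.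
  - by rewrite mul0r mulr0.
have ab' : (s o0 : nat) != s o1 by [].
have [a_odd|a_even] := boolP (odd (s o0)); last first.
  by apply/ltW/(T_even s (s o0)) => //; lia.
pose s' := (tperm o0 o1 * s)%g.
have -> : T s = T s'.
  rewrite /T /s' odd_permM odd_tperm o01 !permM tpermL tpermR.
  have -> : (fun j : 'I_(k * 2) => pairs x y ((tperm o0 o1 * s)%g (rshift 2 j))) =
            (fun j : 'I_(k * 2) => pairs x y (s (rshift 2 j))).
    by apply/funext => j; rewrite permM tpermD.
  have -> : w (pairs x y (s o0)) (pairs x y (s o1)) =
            - w (pairs x y (s o1)) (pairs x y (s o0)).
    rewrite /pairs a_odd.
    have -> : odd (s o1) = false by lia.
    have [-> _ _ _] := wxy _ _ (idx (s o1)) (idx (s o0)).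
    by have [_ -> _ _] := wxy _ _ (idx (s o1)) (idx (s o0)).
  by rewrite signr_addb expr1 mulN1r mulNr !mulNr mulrN.
apply/ltW/(T_even s' (s o1)); rewrite /s' ?permM ?tpermL ?tpermR //; lia.
Qed.

Definition frame (z : V) (x y : nat -> V) (a : nat) : V :=
  if a is a'.+1 then pairs x y a' else z.

(** As [al] kills every vector of the frame but [z], only the permutations fixing 0 contribute;
    antisymmetry of the wedge power cancels their signs. *)
Lemma wedge_form1_darboux_gt0 (al : V -> R) w z x y k : darboux w x y k ->
  al z = 1 -> (forall i, (i < k)%N -> al (x i) = 0 /\ al (y i) = 0) ->
  0 < wedge (form1 al) (wedge_exp (form2 w) k)
        (fun j : 'I_(1 + k * 2) => frame z x y j).
Proof.
move=> wxy alz alxy.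
pose o0 : 'I_(1 + k * 2) := lshift (k * 2) (ord0 : 'I_1).
have o0E : o0 = ord0 by apply: val_inj.
pose T (s : 'S_(1 + k * 2)) := (-1) ^+ s * (al (frame z x y (s o0)) *
  wedge_exp (form2 w) k (fun j : 'I_(k * 2) => frame z x y (s (rshift 1 j)))).
have T0 (s : 'S_(1 + k * 2)) : s o0 = ord0 -> 0 < T s.
  move=> s0; have [t st] := lift_perm_ord0 (s : 'S_(k * 2).+1).
  have s00 : s ord0 = ord0 by rewrite -{1}o0E.
  have sgn : s = t :> bool by rewrite {1}st odd_lift_perm s00.
  have sE (j : 'I_(k * 2)) : frame z x y (s (rshift 1 j)) = pairs x y (t j).
    have -> : rshift 1 j = lift ord0 j by apply: val_inj.
    by rewrite {1}st lift_perm_lift s00.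
  rewrite /T s0 /= alz mul1r (funext sE).
  rewrite (@wedge_exp_perm 2 (form2 w) k (fun j => pairs x y j)).
  by rewrite sgn mulrA -signr_addb addbb mul1r wedge_exp_darboux_gt0.
suff : 0 < \sum_s T s.
  move=> sT; rewrite /wedge.
  apply: mulr_gt0; last exact: sT.
  by rewrite invr_gt0 ltr0n muln_gt0 !fact_gt0.
rewrite (bigD1 (1%g : 'S_(1 + k * 2))) //= ltr_wpDr //; last first.
  by apply: T0; rewrite perm1 o0E.
apply: sumr_ge0 => s _.
have [s0|s0] := eqVneq (s o0) ord0; first exact/ltW/T0.
rewrite /T.
suff -> : al (frame z x y (s o0)) = 0 by rewrite mul0r mulr0.
have [a sa] : exists a, s o0 = a.+1 :> nat.
  by exists (s o0).-1; move: s0; rewrite -val_eqE /=; lia.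
have ak : (a./2 < k)%N by have := ltn_ord (s o0); rewrite sa; lia.
by rewrite sa /= /pairs; have [ax ay] := alxy _ ak; case: (odd a).
Qed.

End Wedge_positivity.

(** * Orthonormal frames adapted to an almost contact metric structure *)

Section Adapted_frames.
Context (R : realType) (m : nat).
Local Notation V := 'rV[R]_m.
Variable g : V -> V -> R.
Hypothesis g_linear : forall u, scalar (g u).
Hypothesis g_sym : forall u v, g u v = g v u.
Hypothesis g_pos : forall v, v != 0 -> 0 < g v v.

Let gDr u a v w : g u (a *: v + w) = a * g u v + g u w.
Proof. exact: g_linear. Qed.

Let gNr u v : g u (- v) = - g u v.
Proof.
have g0 : g u 0 = 0 by exact: (linear_fun0 (W := R) (g_linear u)).
by have := gDr u (-1) v 0; rewrite scaleN1r addr0 mulN1r g0 addr0.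
Qed.

Let gZr u a v : g u (a *: v) = a * g u v.
Proof.
have g0 : g u 0 = 0 by exact: (linear_fun0 (W := R) (g_linear u)).
by have := gDr u a v 0; rewrite g0 !addr0.
Qed.

Definition orthonormal_family N (b : 'I_N -> V) : Prop :=
  forall i j, g (b i) (b j) = (i == j)%:R.

(** Pairing a linear relation with [b i] isolates its i-th coefficient, so the family is
    independent. *)
Lemma orthonormal_family_size N (b : 'I_N -> V) :
  orthonormal_family b -> (N <= m)%N.
Proof.
move=> gb; rewrite -[N](_ : \rank (\matrix_i b i) = N) ?rank_leq_col //.
apply/eqP; rewrite -[_ == _]/(row_free _) -kermx_eq0; apply/rowV0P => c /sub_kermxP.
rewrite mulmx_sum_row => cb; apply/rowP => i; rewrite [RHS]mxE.
have <- : g (b i) (\sum_j c 0 j *: b j) = c 0 i.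
  rewrite (scalar_sum _ _ _ (g_linear _)) (bigD1 i) //= gb eqxx mulr1.
  rewrite big1 ?addr0 // => j ji; by rewrite gb eq_sym (negbTE ji) mulr0.
have <- : \sum_j c 0 j *: row j (\matrix_i b i) = \sum_j c 0 j *: b j.
  by apply: eq_bigr => j _; rewrite rowK.
by rewrite cb; exact: (linear_fun0 (W := R) (g_linear _)).
Qed.

(** Orthogonality to N < m vectors is a linear system with a nonzero solution, which is then
    normalized. *)
Lemma orthogonal_unit_vector N (b : 'I_N -> V) : (N < m)%N ->
  exists2 e, g e e = 1 & forall i, g e (b i) = 0.
Proof.
move=> Nm; pose A := \matrix_(l < m, j < N) g (delta_mx 0 l) (b j).
have : kermx A != 0.
  rewrite -mxrank_eq0 mxrank_ker subn_eq0 -ltnNge.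
  exact: leq_ltn_trans (rank_leq_col _) Nm.
move=> /rowV0Pn[u /sub_kermxP uA u0].
have gu0 := g_pos u0.
have gub i : g u (b i) = 0.
  rewrite g_sym {1}(row_sum_delta u) (scalar_sum _ _ _ (g_linear _)).
  have : (u *m A) 0 i = 0 by rewrite uA mxE.
  rewrite mxE => H; rewrite -[RHS]H; apply: eq_bigr => l _.
  by rewrite mxE g_sym.
exists ((Num.sqrt (g u u))^-1 *: u) => [|i].
  rewrite gZr g_sym gZr mulrA -invfM -expr2 sqr_sqrtr ?ltW //.
  by rewrite mulVf // gt_eqF.
by rewrite g_sym gZr g_sym gub mulr0.
Qed.

Variables (f : V -> V) (z : V).
Hypothesis f_sq : forall v, f (f v) = - v + g v z *: z.
Hypothesis fz : f z = 0.
Hypothesis gzz : g z z = 1.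
Hypothesis f_skew : forall u v, g u (f v) = - g v (f u).

Let gf_z u : g (f u) z = 0.
Proof. by rewrite g_sym f_skew fz -[0](scale0r z) gZr mul0r oppr0. Qed.

Let gff u v : g v z = 0 -> g (f u) (f v) = g u v.
Proof.
by move=> vz; rewrite f_skew f_sq addrC gDr gNr vz mulr0 add0r opprK g_sym.
Qed.

(** Only the [e i] are recorded: by [f_sq] and [f_skew] these relations make the whole family z, f
    e_0, e_0, f e_1, e_1, ... orthonormal. *)
Definition adapted (k : nat) (e : nat -> V) : Prop :=
  forall i j, (i < k)%N -> (j < k)%N ->
  [/\ g (e i) z = 0, g (e i) (e j) = (i == j)%:R & g (e i) (f (e j)) = 0].

Lemma adapted_orthonormal k e : adapted k e ->
  orthonormal_family (fun j : 'I_(1 + k * 2) => frame z (f \o e) e j).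
Proof.
move=> ek [a ha] [b hb] /=; rewrite -val_eqE /=.
have half c : (c.+1 < 1 + k * 2)%N -> (c./2 < k)%N by lia.
case: a b ha hb => [|a] [|b] ha hb //=; rewrite ?eqSS /pairs /=.
- have [bz _ _] := ek _ _ (half _ hb) (half _ hb).
  by case: ifP => _; rewrite g_sym.
- have [az _ _] := ek _ _ (half _ ha) (half _ ha).
  by case: ifP.
have [az ee ef] := ek _ _ (half _ ha) (half _ hb).
have [bz _ fe] := ek _ _ (half _ hb) (half _ ha).
case: ifP => oa; case: ifP => ob.
- by rewrite ee; congr (_%:R); congr nat_of_bool; lia.
- by rewrite ef (_ : (a == b) = false) //; lia.
- by rewrite g_sym fe (_ : (a == b) = false) //; lia.
- by rewrite gff // ee; congr (_%:R); congr nat_of_bool; lia.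
Qed.

(** Putting f e_i before e_i makes the sign right: g (f e_i) (f e_j) = g e_i e_j, because f is an
    isometry on the orthogonal complement of z. *)
Lemma adapted_darboux k e : adapted k e ->
  darboux (fun u v => g u (f v)) (f \o e) e k.
Proof.
move=> ek i j ik jk; have [iz ee ef] := ek _ _ ik jk.
have [jz _ fe] := ek _ _ jk ik.
split => /=.
- by rewrite gff.
- by rewrite f_skew gff // ee.
- by rewrite gff // gf_z.
- by [].
Qed.

Lemma adapted_extend k e : adapted k e -> (1 + k * 2 < m)%N ->
  exists e', adapted k.+1 e'.
Proof.
move=> ek km.
have [u guu gub] := orthogonal_unit_vector
  (fun j : 'I_(1 + k * 2) => frame z (f \o e) e j) km.
have uz : g u z = 0 by have := gub (Ordinal (isT : 0 < 1 + k * 2)%N).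
(* In [frame], z has position 0, f (e i) has position 2i + 1 and e i has position 2i + 2. *)
have ue i : (i < k)%N -> g u (e i) = 0.
  move=> ik; have ltN : (i.*2.+2 < 1 + k * 2)%N by lia.
  by have := gub (Ordinal ltN); rewrite /= /pairs /= odd_double /= uphalf_double.
have ufe i : (i < k)%N -> g u (f (e i)) = 0.
  move=> ik; have ltN : (i.*2.+1 < 1 + k * 2)%N by lia.
  by have := gub (Ordinal ltN); rewrite /= /pairs /= odd_double half_double.
have ufu : g u (f u) = 0 by have := f_skew u u; lra.
exists (fun i => if i == k then u else e i) => i j ik jk.
have [i_k|i_k] := eqVneq i k; have [j_k|j_k] := eqVneq j k.
- by rewrite i_k j_k eqxx.
- have jk1 : (j < k)%N by lia.
  by rewrite i_k eq_sym (negbTE j_k) ue // ufe.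
- have ik1 : (i < k)%N by lia.
  have [iz _ _] := ek _ _ ik1 ik1.
  by rewrite j_k (negbTE i_k) f_skew ufe // oppr0 [g (e i) u]g_sym ue.
- by apply: ek; lia.
Qed.

(** An adapted family of size j spans 1 + 2j <= m dimensions, and it can be extended unless equality
    holds. Equality must occur before size m, as 1 + 2m <= m is absurd. *)
Lemma adapted_exists : exists2 k, (1 + k * 2 = m)%N & exists e, adapted k e.
Proof.
have step j : (exists2 k, (1 + k * 2 = m)%N & exists e, adapted k e) \/
    exists e, adapted j e.
  elim: j => [|j [done|[e ej]]]; [by right; exists (fun=> 0) | by left |].
  have := orthonormal_family_size (adapted_orthonormal ej).
  rewrite leq_eqVlt => /orP[/eqP jm|jm]; first by left; exists j => //; exists e.
  by right; exact: adapted_extend ej jm.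
have [//|[e em]] := step m.
by have := orthonormal_family_size (adapted_orthonormal em); lia.
Qed.

End Adapted_frames.

Lemma contact_wedge_neq0 (R : realType) m (g : 'rV[R]_m -> 'rV[R]_m -> R)
    (f : 'rV[R]_m -> 'rV[R]_m) (z : 'rV[R]_m) (al : 'rV[R]_m -> R)
    (w : 'rV[R]_m -> 'rV[R]_m -> R) :
  (forall u, scalar (g u)) -> (forall u v, g u v = g v u) ->
  (forall v, v != 0 -> 0 < g v v) ->
  (forall v, f (f v) = - v + al v *: z) -> f z = 0 -> al z = 1 ->
  (forall v, g v z = al v) -> (forall u v, g u (f v) = w u v) ->
  (forall u v, w u v = - w v u) ->
  exists2 k, (1 + k * 2 = m)%N &
    exists v, wedge (form1 al) (wedge_exp (form2 w) k) v != 0.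
Proof.
move=> lg sg pg ff fz alz gz gw wskew.
have f_sq v : f (f v) = - v + g v z *: z by rewrite ff gz.
have gzz : g z z = 1 by rewrite gz.
have f_skew u v : g u (f v) = - g v (f u) by rewrite !gw.
have [k km [e ek]] := adapted_exists lg sg pg f_sq fz gzz f_skew.
exists k => //; exists (fun j => frame z (f \o e) e j); rewrite gt_eqF //.
have wE : w = fun u v => g u (f v) by apply/funext => u; apply/funext => v.
apply: wedge_form1_darboux_gt0 => //.
  by rewrite wE; exact: (adapted_darboux lg sg f_sq fz f_skew ek).
move=> i ik; have [iz _ _] := ek _ _ ik ik.
split; last by rewrite -gz.
rewrite /= -gz sg f_skew fz; have := linear_fun0 (W := R) (lg (e i)).
by move=> ->; rewrite oppr0.
Qed.

(** * Integral manifolds of a characteristic distribution *)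

(** Serves both choices of indices: [a] is the form to be restricted and [b] the one whose
    characteristic distribution is integrated. The formula for the square of [f] is asked only where
    [b] vanishes, since there the term in the other Reeb field disappears. *)
Lemma integral_manifold_contact_metric (R : realType) (n : nat)
    (M : manifold R n) (a b : forall p : M, tangent p -> R)
    (Z : forall p : M, tangent p) (f : forall p : M, tangent p -> tangent p)
    (g : forall p : M, tangent p -> tangent p -> R)
    (m : nat) (L : manifold R m) (i : L -> M) :
  one_form a -> vector_field Z -> endomorphism_field f -> riemannian_metric g ->
  (forall p, a p (Z p) = 1) -> (forall p v, ext_deriv a (Z p) v = 0) ->
  (forall p, char_distribution b p (Z p)) ->
  (forall p, f p @` char_distribution b p `<=` char_distribution b p) ->
  (forall p, f p (Z p) = 0) ->
  (forall p v, b p v = 0 -> f p (f p v) = - v + a p v *: Z p) ->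
  (forall p (u v : tangent p),
     g p u (f p v) = ext_deriv a u v + ext_deriv b u v) ->
  (forall p u, g p u (Z p) = a p u) ->
  connected_integral_manifold (char_distribution b) i ->
  induces_contact_metric i a Z f g.
Proof.
move=> fa fZ [lf fk] rg aZ daZ bZ fD fZ0 ff gf gZ [[[q0 _] _] i_smooth _ i_inj rangeE].
have [la _] := fa.
have tmD q (v : tangent q) : char_distribution b (i q) (tangent_map i v).
  by rewrite -rangeE; exists v.
have lift q w : char_distribution b (i q) w ->
    exists v : tangent q, tangent_map i v = w.
  by rewrite -rangeE => -[v _ <-]; exists v.
have fL_ex q (v : tangent q) : exists v', tangent_map i v' = f (i q) (tangent_map i v).
  by apply: lift; apply: fD; exists (tangent_map i v).
(* The restrictions are picked by choice; their algebraic identities are checked after applying the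
   injective [tangent_map i]. *)
pose ZL q : tangent q := sval (cid (lift q _ (bZ (i q)))).
pose fL q (v : tangent q) : tangent q := sval (cid (fL_ex q v)).
have ZLE q : tangent_map i (ZL q) = Z (i q) by rewrite /ZL; case: cid.
have fLE q v : tangent_map i (fL q v) = f (i q) (tangent_map i v).
  by rewrite /fL; case: cid.
have tm_linear q := tangent_map_linear i_smooth (q := q).
have tmN q (v : tangent q) : tangent_map i (- v) = - tangent_map i v.
  exact: linear_funN (tm_linear q).
have daE q (u v : tangent q) : ext_deriv (pullback1 i a) u v =
    ext_deriv a (tangent_map i u) (tangent_map i v) by exact: ext_deriv_pullback1.
have fL_linear q : linear (fL q).
  by move=> k u v; apply: i_inj; rewrite !(fLE, tm_linear, lf).
have fL_sq q v : fL q (fL q v) = - v + pullback1 i a q v *: ZL q.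
  apply: i_inj; rewrite !fLE ff; last by have [] := tmD q v.
  by rewrite [in RHS]addrC tm_linear ZLE tmN addrC.
have fLZ q : fL q (ZL q) = 0.
  by apply: i_inj; rewrite fLE ZLE fZ0 (linear_fun0 (tm_linear q)).
have aZL q : pullback1 i a q (ZL q) = 1 by rewrite /pullback1 ZLE.
have gfL q (u v : tangent q) :
    pullback2 i g q u (fL q v) = ext_deriv (pullback1 i a) u v.
  by rewrite /pullback2 fLE gf daE (tmD q u).2 addr0.
have gZL q u : pullback2 i g q u (ZL q) = pullback1 i a q u.
  by rewrite /pullback2 ZLE gZ.
have fal : one_form (pullback1 i a) by exact: pullback1_one_form.
have rgL : riemannian_metric (pullback2 i g) by exact: pullback2_riemannian.
have [lgL sgL pgL _] := rgL.
have wedgeL q : exists2 k, (1 + k * 2 = m)%N & exists v, wedge (form1 (pullback1 i a q))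
    (wedge_exp (form2 (@ext_deriv R m L (pullback1 i a) q)) k) v != 0.
  apply: (contact_wedge_neq0 (lgL q) (sgL q) (pgL q) (fL_sq q) (fLZ q) (aZL q)
    (gZL q) (gfL q)).
  by move=> u v; rewrite /ext_deriv opprB.
exists ZL, fL; split => //; split => //.
- split => //; split => //.
  + move=> c; apply: (smooth_of_tangent_map i_smooth) => // d k.
    have oU : open (overlap i c d) by exact: overlap_open.
    apply: Ck_row => // j.
    pose F p := components d (Z p) 0 j.
    have Fd : smooth_in_chart d F.
      move=> k'; apply: (Ck_coord (f := (fun p => components d (Z p)) \o param d)).
        exact: chart_image_open.
      exact: fZ.
    apply: (eq_Ck oU _ (Ck_pullback i_smooth c k Fd)) => x _.
    by rewrite /= ZLE.
  + split => // c v; apply: (smooth_of_tangent_map i_smooth) => // d k.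
    have oU : open (overlap i c d) by exact: overlap_open.
    apply: Ck_row => // l.
    pose F j p := components d (f p (coord_vec d p (delta_mx 0 j))) 0 l.
    have Fd j : smooth_in_chart d (F j).
      move=> k'; apply: (Ck_coord (f := (fun p => components d
        (f p (coord_vec d p (delta_mx 0 j)))) \o param d)).
        exact: chart_image_open.
      exact: fk.
    have FE x : overlap i c d x ->
        \sum_j 'D_v (local_rep i c d) x 0 j * (F j \o i \o param c) x =
        components d (tangent_map i (fL (param c x) (coord_vec c (param c x) v))) 0 l.
      move=> [q [cq dq] <-]; rewrite fLE /= chartK //.
      rewrite (tangent_map_coord_vec i_smooth _ cq dq).
      rewrite {2}(row_sum_delta ('D_v _ _)) (linear_fun_sum _ _ _ (coord_vec_linear dq)).
      rewrite (linear_fun_sum _ _ _ (lf _)) (linear_fun_sum _ _ _ (components_linear dq)).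
      by rewrite summxE; apply: eq_bigr => j _; rewrite mxE.
    apply: (eq_Ck oU FE); apply: Ck_sum => // j _; apply: CkM => //.
      apply: Ck_coord => //.
      by have [_ /(_ v)] := local_rep_smooth i_smooth c d k.+1.
    exact: Ck_pullback.
(* A contact form needs one exponent for all points: it is read off at [q0], and 1 + 2k = m forces
   the same value elsewhere. *)
- split => //; have [k km _] := wedgeL q0; exists k; split => // q.
  by have [k' k'm] := wedgeL q; have <- : k' = k by lia.
- by move=> q; split => // v; rewrite daE ZLE.
Qed.

Theorem theorem16 (R : realType) (n h k : nat) (M : manifold R n)
    (alpha1 alpha2 : forall p : M, tangent p -> R)
    (Z1 Z2 : forall p : M, tangent p)
    (phi : forall p : M, tangent p -> tangent p)
    (g : forall p : M, tangent p -> tangent p -> R) :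
  metric_contact_pair h k alpha1 alpha2 Z1 Z2 phi g ->
  decomposable alpha1 alpha2 phi ->
  (forall (m : nat) (L : manifold R m) (i : L -> M),
     leaf (char_distribution alpha2) i ->
     induces_contact_metric i alpha1 Z1 phi g) /\
  (forall (m : nat) (L : manifold R m) (i : L -> M),
     leaf (char_distribution alpha1) i ->
     induces_contact_metric i alpha2 Z2 phi g).
Proof.
move=> [[[fa1 fa2 _ _ _] [[fZ1 fZ2] a1Z a2Z da1Z da2Z] fphi phi2 phiZ] rg gphi gZ] dec.
split=> m L i [i_int _].
- apply: (integral_manifold_contact_metric (b := alpha2)) i_int => //.
  + by move=> p; have [] := a1Z p.
  + by move=> p v; have [] := da1Z p v.
  + by move=> p; split=> [|v]; [have [] := a2Z p|have [] := da2Z p v].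
  + by move=> p; have [] := dec p.
  + by move=> p; have [] := phiZ p.
  + by move=> p v a2v; rewrite phi2 a2v scale0r addr0.
  + by move=> p u; have [] := gZ p u.
- apply: (integral_manifold_contact_metric (b := alpha1)) i_int => //.
  + by move=> p; have [] := a2Z p.
  + by move=> p v; have [] := da2Z p v.
  + by move=> p; split=> [|v]; [have [] := a1Z p|have [] := da1Z p v].
  + by move=> p; have [] := dec p.
  + by move=> p; have [] := phiZ p.
  + by move=> p v a1v; rewrite phi2 a1v scale0r addr0.
  + by move=> p u v; rewrite addrC.
  + by move=> p u; have [] := gZ p u.
Qed.
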